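(* Let $B:=C([1,\infty],\mathbb{M}_2)$ be the $C^*$-algebra of all continuous functions from the extended interval $[1,\infty]$ to $\mathbb{M}_2$. Let $A$ be the $C^*$-subalgebra of $B$ consisting of all $a\in B$ for which there is a convergent sequence $(\lambda_n(a))_{n\in\mathbb{N}}$ of complex numbers such that $$a(n)=\begin{bmatrix}\lambda_n(a) & 0\\ 0 & \lambda_{n+1}(a)\end{bmatrix}\qquad (n\in\mathbb{N}).$$ Then $A$ admits an outer automorphism which is also an elementary operator on $A$.
   Context: $\mathbb{M}_2$ is the algebra of $2\times 2$ complex matrices, $[1,\infty]$ is the one-point compactification of $[1,\infty)$, and $\mathbb{N}=\{1,2,\dots\}$. The $C^*$-algebra $A$ is unital. An automorphism of a unital $C^*$-algebra $A$ is inner if it is of the form $x\mapsto axa^{-1}$ for some invertible $a\in A$, and outer otherwise. An elementary operator on a unital $C^*$-algebra $A$ is a map $A\to A$ that is a finite sum of maps $x\mapsto axb$ with $a,b\in A$. *)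

(* Defs.v *)
From HB Require Import structures.
From mathcomp Require Import all_boot all_order all_algebra.
From mathcomp Require Import complex.
From mathcomp Require Import all_classical all_reals all_analysis.
Import Order.TTheory GRing.Theory Num.Theory numFieldNormedType.Exports.

Set Implicit Arguments.
Unset Strict Implicit.
Unset Printing Implicit Defensive.

Local Open Scope classical_set_scope.
Local Open Scope ring_scope.

(* MathComp-Analysis provides the pointwise ring and module structures on
   functions; these instances add the compatibility laws of an algebra. *)
Section fct_alg.
Variables (U : pointedType) (K : pzRingType).

Lemma fct_scalerAl (V : lalgType K) (k : K) (f g : U -> V) :
  k *: (f * g) = (k *: f) * g.
Proof. by apply/funext => x; rewrite !fctE scalerAl. Qed.

HB.instance Definition _ (V : lalgType K) :=
  GRing.Lmodule_isLalgebra.Build K (U -> V) (@fct_scalerAl V).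

Lemma fct_scalerAr (V : algType K) (k : K) (f g : U -> V) :
  k *: (f * g) = f * (k *: g).
Proof. by apply/funext => x; rewrite !fctE scalerAr. Qed.

HB.instance Definition _ (V : algType K) :=
  GRing.Lalgebra_isAlgebra.Build K (U -> V) (@fct_scalerAr V).

End fct_alg.

Section continuous_mx.
Variables (T : topologicalType) (K : numFieldType).

Lemma continuous_mxP m n (f : T -> 'M[K]_(m, n)) :
  continuous f <-> forall i j, continuous (fun t => f t i j).
Proof.
split=> [cf i j t|cf t A [P nP PA]].
  by apply: (@continuous_comp _ _ _ f (fun M : 'M[K]_(m, n) => M i j));
    [exact: cf | exact: coord_continuous].
rewrite /nbhs /=.
have : \forall s \near t, forall ij : 'I_m * 'I_n, P ij.1 ij.2 (f s ij.1 ij.2).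
  by apply: filter_forall => -[i j] /=; apply: (cf i j t); exact: nP.
by apply: filterS => s Ps; apply: PA => i j; exact: (Ps (i, j)).
Qed.

Lemma continuous_sum (I : Type) (r : seq I) (F : I -> T -> K) :
  (forall i, continuous (F i)) -> continuous (fun t => \sum_(i <- r) F i t).
Proof.
move=> cF; elim: r => [|i r IHr].
  by under eq_fun do rewrite big_nil; exact: cst_continuous.
under eq_fun do rewrite big_cons.
by move=> x; apply: cvgD; [exact: cF | exact: IHr].
Qed.

End continuous_mx.

Section continuous_matrix_functions.
Variables (T : ptopologicalType) (K : numFieldType) (n : nat).

Definition continuous_mx_pred : {pred T -> 'M[K]_n.+1} :=
  [pred f | `[< continuous f >] ].

Lemma continuous_mx_subalg : GRing.subalg_closed continuous_mx_pred.
Proof.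
split=> [|k f g|f g].
- by apply/asboolP => x; exact: cvg_cst.
- move=> /asboolP /continuous_mxP cf /asboolP /continuous_mxP cg.
  apply/asboolP/continuous_mxP => i j.
  under eq_fun do rewrite !mxE.
  by move=> x; apply: cvgD; [apply: cvgMr; exact: cf | exact: cg].
- move=> /asboolP /continuous_mxP cf /asboolP /continuous_mxP cg.
  apply/asboolP/continuous_mxP => i j.
  under eq_fun do rewrite mxE.
  by apply: continuous_sum => k x; apply: cvgM; [exact: cf | exact: cg].
Qed.

HB.instance Definition _ :=
  GRing.isSubalgClosed.Build K (T -> 'M[K]_n.+1) continuous_mx_pred
    (GRing.subalg_closed_semi continuous_mx_subalg).

(* C(T, M_{n+1}(K)) with the pointwise operations. *)
Record cmx := CMx {
  cmx_fun :> T -> 'M[K]_n.+1;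
  cmx_funP : cmx_fun \in continuous_mx_pred }.

HB.instance Definition _ := [isSub for cmx_fun].
HB.instance Definition _ := [Choice of cmx by <:].
HB.instance Definition _ := [SubChoice_isSubAlgebra of cmx by <:].

Lemma cmx_continuous (f : cmx) : continuous f.
Proof. by apply/asboolP; exact: cmx_funP. Qed.

End continuous_matrix_functions.

Section inner_elementary.
Variable A : pzRingType.
Implicit Type phi : A -> A.

Definition inner phi := exists a b : A,
  [/\ a * b = 1, b * a = 1 & forall x, phi x = a * x * b].

Definition outer phi := ~ inner phi.

Definition elementary phi := exists s : seq (A * A),
  forall x, phi x = \sum_(p <- s) p.1 * x * p.2.

End inner_elementary.

(* C stands for the complex numbers R[i]. It is a variable of type
   [numClosedFieldType] because the library attaches the topology of the modulus
   to numeric fields, and inference does not find it on a bare [R[i]]. *)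
Section the_algebra.
Variables (R : realType) (C : numClosedFieldType).

(* [1, oo), with the topology induced by R. *)
Definition ray : topologicalType := `[1 : R, +oo[%classic.

(* [1, oo]; [None] is the point at infinity. *)
Definition eray : ptopologicalType := one_point_compactification ray.

Lemma nat_in_ray (n : nat) : (0 < n)%N -> (n%:R : R) \in `[1 : R, +oo[%classic.
Proof. by move=> n0; rewrite inE /= in_itv /= andbT ler1n. Qed.

Definition nat_ray (n : nat) (n0 : (0 < n)%N) : ray :=
  exist (fun x : R => x \in `[1, +oo[%classic) n%:R (nat_in_ray n0).

Definition nat_pt (n : nat) (n0 : (0 < n)%N) : eray :=
  Some (nat_ray n0).

(* The 1 is the predecessor of the size: matrices are 2 x 2. *)
Notation algB := (cmx eray C 1).

(* diag (lambda_n, lambda_{n+1}): the entry of index (j, j) is lambda_{n+j},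
   for j = 0, 1. *)
Definition shift_diag (lambda : nat -> C) (n : nat) : 'M[C]_2 :=
  diag_mx (\row_(j < 2) lambda (n + j)%N).

(* Sequences are indexed from 1, so lambda 0 is a dummy value. *)
Definition algA_pred : {pred algB} := [pred a : algB |
  `[< exists lambda : nat -> C, cvg (lambda @ \oo) /\
      forall (n : nat) (n0 : (0 < n)%N), a (nat_pt n0) = shift_diag lambda n >] ].

Lemma algA_subalg : GRing.subalg_closed algA_pred.
Proof.
split=> [|k a b|a b].
- apply/asboolP; exists (fun=> 1); split; first exact: is_cvg_cst.
  by move=> n n0; apply/matrixP => i j; rewrite !mxE.
- move=> /asboolP[u [cu ua]] /asboolP[v [cv vb]]; apply/asboolP.
  exists (fun n => k * u n + v n); split.
    move/cvg_ex : cu => [l ul]; move/cvg_ex : cv => [m vm].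
    apply/cvg_ex; exists (k * l + m).
    by apply: cvgD => //; apply: cvgMr.
  move=> n n0; have -> : (k *: a + b : algB) (nat_pt n0) =
    k *: a (nat_pt n0) + b (nat_pt n0) by [].
  rewrite ua vb; apply/matrixP => i j; rewrite !mxE.
  by case: (i == j); rewrite ?mulr1n // !mulr0n mulr0 addr0.
- move=> /asboolP[u [cu ua]] /asboolP[v [cv vb]]; apply/asboolP.
  exists (fun n => u n * v n); split.
    move/cvg_ex : cu => [l ul]; move/cvg_ex : cv => [m vm].
    by apply/cvg_ex; exists (l * m); exact: cvgM ul vm.
  move=> n n0; have -> : (a * b : algB) (nat_pt n0) =
    a (nat_pt n0) *m b (nat_pt n0) by [].
  rewrite ua vb /shift_diag mulmx_diag; congr diag_mx.
  by apply/rowP => j; rewrite !mxE.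
Qed.

HB.instance Definition _ :=
  GRing.isSubalgClosed.Build C algB algA_pred
    (GRing.subalg_closed_semi algA_subalg).

Record algA := AlgA {
  algA_val :> algB;
  algA_valP : algA_val \in algA_pred }.

HB.instance Definition _ := [isSub for algA_val].
HB.instance Definition _ := [Choice of algA by <:].
HB.instance Definition _ := [SubChoice_isSubAlgebra of algA by <:].

Lemma algA1E t : (1 : algA) t = 1%:M. Proof. by []. Qed.
Lemma algADE (a b : algA) t : (a + b) t = a t + b t. Proof. by []. Qed.
Lemma algAME (a b : algA) t : (a * b) t = a t *m b t. Proof. by []. Qed.
Lemma algAZE (k : C) (a : algA) t : (k *: a) t = k *: a t. Proof. by []. Qed.

(* Together with its being a unital subalgebra, closure under the adjoint and
   under uniform limits says that A is a C*-subalgebra of B. *)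
Lemma adj_subproof (b : algB) :
  (fun t => (b t)^t*%sesqui) \in @continuous_mx_pred eray C 1.
Proof.
apply/asboolP/continuous_mxP => i j; under eq_fun do rewrite !mxE.
move=> t; apply: (@continuous_comp _ _ _ (fun t => b t j i) (@Num.conj C)).
  have /continuous_mxP := @cmx_continuous _ _ _ b; exact.
move=> V /nbhs_ballP[e /= e0 eV]; apply/nbhs_ballP; exists e => //= z.
rewrite -ball_normE /= => bz; apply: eV.
by rewrite -ball_normE /= -rmorphB norm_conjC.
Qed.

Definition adj (b : algB) : algB := CMx (adj_subproof b).

Lemma algA_adj (a : algB) : a \in algA_pred -> adj a \in algA_pred.
Proof.
move=> /asboolP[u [cu ua]]; apply/asboolP; exists (fun n => (u n)^* ); split.
  move/cvg_ex : cu => [l /cvgrPdist_lt ul]; apply/cvg_ex; exists l^*.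
  apply/cvgrPdist_lt => e /ul; apply: filterS => n.
  by rewrite -rmorphB norm_conjC.
move=> n n0; apply/matrixP => i j; rewrite /= ua !mxE eq_sym.
case: eqP => [->|_]; first by rewrite !mulr1n.
by rewrite !mulr0n rmorph0.
Qed.

Lemma nat_pt_cvg : nat_pt (ltn0Sn n) @[n --> \oo] --> (None : eray).
Proof.
move=> V [K [cK _] KV].
have : bounded_set ((\val : ray -> R) @` K).
  apply: compact_bounded; apply: continuous_compact => //.
  by apply: continuous_subspaceT; exact: initial_continuous.
case=> M [Mr MK]; change (\forall n \near \oo, V (nat_pt (ltn0Sn n))).
near=> n; apply: KV; left.
exists (nat_ray (ltn0Sn n)) => // Kn.
have : `|n.+1%:R : R| <= M + 1.
  apply: (MK (M + 1)); first by rewrite ltrDl.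
  by exists (nat_ray (ltn0Sn n)).
apply/negP; rewrite -ltNge normr_nat.
near: n; exists (Num.trunc (`|M| + 1)) => // n /= Mn.
apply: le_lt_trans (_ : `|M| + 1 < _); first by rewrite lerD2r ler_norm.
apply: lt_le_trans (truncnS_gt _) _.
by rewrite ler_nat ltnS.
Unshelve. all: by end_near. Qed.

Lemma mx_norm_lt_entry (x : 'M[C]_2) (e : C) i j : `|x| < e -> `|x i j| < e.
Proof.
move=> xe; have : ball (0 : 'M[C]_2) e x by rewrite -ball_normE /= sub0r normrN.
by case=> _ /(_ i j); rewrite -ball_normE /= mxE sub0r normrN.
Qed.

Lemma algA_closed (a : algB) :
  (forall e : C, 0 < e ->
    exists2 b : algB, b \in algA_pred & forall t, `|a t - b t| < e) ->
  a \in algA_pred.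
Proof.
move=> aA.
have ent (x : C) : (forall e, 0 < e -> `|x| < e) -> x = 0.
  have [//|x0 xe] := eqVneq x 0.
  by have := xe `|x|; rewrite normr_gt0 x0 ltxx => /(_ isT).
have off n (n0 : (0 < n)%N) i j : i != j -> a (nat_pt n0) i j = 0.
  move=> ij; apply: ent => e /aA[b /asboolP[v [_ vb]] ab].
  have := mx_norm_lt_entry i j (ab (nat_pt n0)).
  by rewrite vb !mxE (negbTE ij) mulr0n subr0.
have shift n (n0 : (0 < n)%N) :
    a (nat_pt n0) 1 1 = a (nat_pt (ltn0Sn n)) 0 0.
  apply/eqP; rewrite -subr_eq0; apply/eqP; apply: ent => e e0.
  have e20 : 0 < e / 2 by rewrite divr_gt0.
  have [b /asboolP[v [_ vb]] ab] := aA _ e20.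
  have h1 := mx_norm_lt_entry 1 1 (ab (nat_pt n0)).
  have h2 := mx_norm_lt_entry 0 0 (ab (nat_pt (ltn0Sn n))).
  move: h1 h2; rewrite !vb !mxE !eqxx !mulr1n /= addn0 addn1 => h1 h2.
  rewrite [ltRHS]splitr; apply: le_lt_trans (ltrD h1 h2).
  rewrite [X in _ <= _ + X]distrC.
  by apply: le_trans (ler_normD _ _); rewrite addrA subrK.
pose lam n : C := if n is m.+1 then a (nat_pt (ltn0Sn m)) 0 0 else 0.
have lamE n (n0 : (0 < n)%N) : lam n = a (nat_pt n0) 0 0.
  by case: n n0 => // n n0; rewrite /lam (bool_irrelevance (ltn0Sn n) n0).
apply/asboolP; exists lam; split.
  apply/cvg_ex; exists (a None 0 0); rewrite -cvg_shiftS /=.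
  have /continuous_mxP/(_ 0 0 None) := @cmx_continuous _ _ _ a.
  exact: (@cvg_comp _ _ _ (fun n => nat_pt (ltn0Sn n)) (fun t => a t 0 0)
    _ _ _ nat_pt_cvg).
move=> n n0; apply/matrixP => i j; rewrite /shift_diag !mxE.
have [->|/off->] := eqVneq i j; last by rewrite mulr0n.
rewrite mulr1n; have [->|j1] := eqVneq j 0; first by rewrite addn0 lamE.
have -> : j = 1 by apply/val_inj; case: j j1 => -[|[|k]] kP //=.
by rewrite addn1 (lamE _ (ltn0Sn n)) shift.
Qed.

End the_algebra.

(* Main.v *)
Require Import Defs.
From HB Require Import structures.
From mathcomp Require Import all_boot all_order all_algebra.
From mathcomp Require Import complex ring lra zify.
From mathcomp Require Import all_classical all_reals all_analysis.
Import Order.TTheory GRing.Theory Num.Theory numFieldNormedType.Exports.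

Set Implicit Arguments.
Unset Strict Implicit.
Unset Printing Implicit Defensive.

Local Open Scope ring_scope.
Local Open Scope complex_scope.
Local Open Scope classical_set_scope.

(** The automorphism is phi(a)(t) = U(t) a(t) U(t)^-1 with U = diag (1, w), where
    w is a positive continuous function on [1, oo] and w(oo) = 1.  At integers
    the values of an element of A are diagonal, hence unchanged by phi; this is why
    phi maps A to A although U itself does not belong to A.

    Outerness.  Suppose phi is implemented by an invertible b in A.  Comparing
    both sides on elements of A carried by a single off-diagonal entry shows
    that b(t) is proportional to U(t) for every noninteger t, hence by continuity
    for every integer t.  At t = n this says lambda_(n+1) = w(n) lambda_n, where
    b(n) = diag (lambda_n, lambda_(n+1)), with all lambda_n nonzero
    ([conj_algA_inner]).  The weight is chosen so that
    w(n) = (n+9)/(n+5) when 4 divides n and w(n) = 1 otherwise; then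
    lambda_(4q) = c (4q+5) with c nonzero, and the sequence diverges
    ([no_harmonic_growth]).

    Elementarity.  phi multiplies the entry (i, j) by u_i/u_j, with u = (1, w).
    If X and Y in A are diagonal with entries x_i and y_j, then
    a |-> a (1 - X Y) + X a Y multiplies the entry (i, j) by
    1 + (x_i - x_j) y_j.  It is enough that this agrees with u_i/u_j at integers:
    the discrepancy is then a continuous function vanishing at every integer,
    and A contains every matrix unit scaled by such a function, so that the
    discrepancy is itself absorbed by an elementary operator
    ([elementary_entry]).  A continuous function x on [1, oo] gives the element
    diag (x(t), x(t+1)) of A, so what remains is to find x and y, vanishing at
    infinity, with
      w(n) = 1 + (x(n+1) - x(n)) y(n) and 1/w(n) = 1 + (x(n) - x(n+1)) y(n+1).
    The tension is that x and y must converge although the product of the w(n)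
    diverges.  It is resolved by letting both oscillate with period 4 and with
    amplitude of order n^(-1/2): along a period x runs through 0, a, a, 0 and y
    through a, a/(1+a^2), 0, 0, so each period contributes w = 1 + a^2, of
    excess 1/n up to a constant ([weight_wave], [weightV_wave]). *)

(** * Continuous functions on [1, oo] *)

Lemma real_complex_continuous (R : realType) :
  continuous (real_complex R : R -> (R[i] : numClosedFieldType)).
Proof.
move=> x; apply/cvgrPdist_lt => e e0.
have eR : (complex.Re e)%:C = e by rewrite RRe_real // gtr0_real.
have eR0 : 0 < complex.Re e by rewrite -ltcR eR.
have : \forall y \near x, `|x - y| < complex.Re e.
  by apply: (@cvgr_dist_lt _ _ _ (nbhs x) _ id).
apply: filterS => y xy.
by rewrite -rmorphB normc_def /= expr0n /= addr0 sqrtr_sqr -eR ltcR.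
Qed.

Section ray.
Variable R : realType.

Lemma max1_in_ray (x : R) : Num.max 1 x \in `[1 : R, +oo[%classic.
Proof. by rewrite inE /= in_itv /= andbT le_max lexx. Qed.

(** A retraction of the line onto [1, oo): it turns statements about the subspace
    into statements about real functions. *)
Definition ray_clamp (x : R) : ray R :=
  exist (fun x : R => x \in `[1, +oo[%classic) _ (max1_in_ray x).

Lemma ray_clamp_continuous : continuous ray_clamp.
Proof.
apply: continuous_comp_initial => x.
by apply: (@continuous_max _ _ (cst 1) id); [exact: cvg_cst | exact: cvg_id].
Qed.

Lemma ray_clampK : cancel (\val : ray R -> R) ray_clamp.
Proof.
move=> r; apply: val_inj; rewrite /= max_r //.
by have := valP r; rewrite inE /= in_itv /= andbT.
Qed.

Definition ray_ext (f : R -> R) (L : R) (t : eray R) : R :=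
  if t is Some r then f (\val (r : ray R)) else L.

(** Neighbourhoods of infinity are the complements of compact sets, and each set
    {t <= M} is compact as the image of [1, M] under the retraction. *)
Lemma ray_ext_continuous (f : R -> R) (L : R) :
  continuous f -> f x @[x --> +oo] --> L -> continuous (ray_ext f L).
Proof.
move=> cf fL [r|] V VL /=.
  have : {for r, continuous (f \o (\val : ray R -> R))}.
    by apply: continuous_comp; [exact: initial_continuous | exact: cf].
  by move=> /(_ V VL).
have [M [Mr MV]] := fL V VL.
have inK (r : ray R) : \val r <= M -> (ray_clamp @` `[1, M]) r.
  move=> rM; exists (\val r); last exact: ray_clampK.
  by have := valP r; rewrite inE /= !in_itv /= andbT rM => ->.
exists (ray_clamp @` `[1, M]).
  split.
    apply: continuous_compact; last exact: segment_compact.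
    exact/continuous_subspaceT/ray_clamp_continuous.
  have -> : ray_clamp @` `[1, M] = (\val : ray R -> R) @^-1` [set x | x <= M].
    apply/seteqP; split => [_ [x /= /[!in_itv]/= /andP[x1 xM] <-]|r /= rM].
      by rewrite /= max_r.
    exact: inK.
  apply: closed_comp; last exact: closed_le.
  by move=> x _; exact: initial_continuous.
move=> _ [[r nr <-]|->]; last exact: nbhs_singleton.
by apply: MV; rewrite ltNge; apply/negP => rM; apply/nr/inK.
Qed.

Lemma continuous_shift (f : R -> R) (k : R) :
  continuous f -> continuous (fun x => f (x + k)).
Proof.
move=> cf; have cD : continuous (fun x : R => x + k).
  by move=> x; apply: cvgD; [exact: cvg_id | exact: cvg_cst].
by move=> x; exact: cvg_comp (cD x) (cf _).
Qed.

Lemma cvg_shift (f : R -> R) (k L : R) :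
  f x @[x --> +oo] --> L -> f (x + k) @[x --> +oo] --> L.
Proof. exact: cvg_comp (cvg_addrr _). Qed.

(** The shift by [k] is what relates the two diagonal entries of an element
    of A, whose sequence is read at n and at n + 1. *)
Definition ray_shift (f : R -> R) (L : R) (k : nat) : eray R -> R :=
  ray_ext (fun x => f (x + k%:R)) L.

Lemma ray_shift_nat (f : R -> R) (L : R) (k n : nat) (n0 : (0 < n)%N) :
  ray_shift f L k (nat_pt R n0) = f (n + k)%:R.
Proof. by rewrite natrD. Qed.

Lemma ray_shift_continuous (f : R -> R) (L : R) (k : nat) :
  continuous f -> f x @[x --> +oo] --> L -> continuous (ray_shift f L k).
Proof.
move=> cf fL; apply: ray_ext_continuous; first exact: continuous_shift.
exact: cvg_shift.
Qed.

End ray.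

Section nat_sine.
Variable R : realType.

Lemma cvg_decay : (1 + `|x|)^-1 @[x --> +oo] --> (0 : R).
Proof.
apply/gtr0_cvgV0; first by near=> x; rewrite ltr_pwDl.
apply: ger_cvgy (@cvg_id _ +oo).
by near=> x; rewrite (le_trans (ler_norm x)) // lerDr.
Unshelve. all: by end_near. Qed.

Lemma decay_continuous : continuous (fun x : R => (1 + `|x|)^-1).
Proof.
move=> x; apply: cvgV; first by rewrite gt_eqF // ltr_pwDl.
exact: cvgD (cvg_cst _) (@norm_continuous _ _ x).
Qed.

(** All the oscillating functions of the construction are bounded factors times
    a vanishing amplitude. *)
Lemma cvg_bounded_mul0 (f d : R -> R) (M : R) :
  (forall x, `|f x| <= M) -> d x @[x --> +oo] --> (0 : R) ->
  f x * d x @[x --> +oo] --> (0 : R).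
Proof.
move=> fM d0; apply/norm_cvg0P.
apply: (@squeeze_cvgr _ _ _ _ (cst 0) (fun x => M * `|d x|)).
- by near=> x; rewrite /= normr_ge0 normrM ler_wpM2r.
- exact: cvg_cst.
- rewrite -(mulr0 M) -(normr0 R); apply: cvgM (cvg_norm d0); exact: cvg_cst.
Unshelve. all: by end_near. Qed.

(** Vanishes exactly at the integers and at infinity: the test function that
    isolates the noninteger points. *)
Definition nat_sine (t : eray R) : R :=
  ray_ext (fun x => sin (pi * x) * (1 + `|x|)^-1) 0 t.

Lemma nat_sine_continuous : continuous nat_sine.
Proof.
apply: ray_ext_continuous.
  have cpi : continuous (fun x : R => pi * x).
    exact: mulrl_continuous.
  move=> x; apply: cvgM (@decay_continuous x).
  exact: cvg_comp (cpi x) (@continuous_sin _ _).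
apply: (@cvg_bounded_mul0 (fun x => sin (pi * x)) _ 1 _ cvg_decay) => x.
exact: sin_max.
Qed.

Lemma sin_nat_pi n (x : R) : sin (x + pi * n%:R) = (-1) ^+ n * sin x.
Proof. by rewrite mulr_natr (alternatingn (@sinDpi R)). Qed.

Lemma nat_sine_nat n (n0 : (0 < n)%N) : nat_sine (nat_pt R n0) = 0.
Proof. by rewrite /nat_sine /= -[pi * _]add0r sin_nat_pi sin0 mulr0 mul0r. Qed.

Lemma nat_sine_neq0 (n : nat) (r : ray R) :
  n%:R < \val r < n.+1%:R -> nat_sine (Some r) != 0.
Proof.
move=> /andP[nr rn]; rewrite /nat_sine /=; apply: mulf_neq0; last first.
  by rewrite invr_neq0 // gt_eqF // ltr_pwDl.
rewrite -(subrK n%:R (\val r)) mulrDr sin_nat_pi.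
apply: mulf_neq0; first by rewrite signr_eq0.
rewrite gt_eqF // sin_gt0_pi // mulr_gt0 ?pi_gt0 ?subr_gt0 //=.
by rewrite gtr_pMr ?pi_gt0 // ltrBlDr addrC natr1.
Qed.

End nat_sine.

(** * Elementary operators *)

Section elementary.
Variable A : pzRingType.

Lemma elementary_mul (a b : A) : elementary (fun x => a * x * b).
Proof. by exists [:: (a, b)] => x; rewrite big_seq1. Qed.

Lemma elementaryD (f g : A -> A) :
  elementary f -> elementary g -> elementary (fun x => f x + g x).
Proof.
by move=> [s fs] [r gr]; exists (s ++ r) => x; rewrite big_cat /= -fs -gr.
Qed.

Lemma elementary_sum (I : Type) (r : seq I) (F : I -> A -> A) :
  (forall i, elementary (F i)) -> elementary (fun x => \sum_(i <- r) F i x).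
Proof.
move=> eF; elim: r => [|i r IHr].
  by exists [::] => x; rewrite !big_nil.
by under eq_fun do rewrite big_cons; exact: elementaryD.
Qed.

End elementary.

(** * Elements of the algebra *)

Section algebra.
Variables (R : realType) (C : numClosedFieldType) (iota : {rmorphism R -> C}).
Hypothesis iota_continuous : continuous iota.

Notation A := (algA R C).

(** Convergence of the sequence [u] is a consequence of the continuity of [M] at
    infinity, since the integers tend to infinity. *)
Lemma algA_of_real (M : eray R -> 'M[R]_2) (u : nat -> R) :
  (forall i j, continuous (fun t => M t i j)) ->
  (forall n (n0 : (0 < n)%N),
     M (nat_pt R n0) = diag_mx (\row_(j < 2) u (n + j)%N)) ->
  exists a : A, forall t, a t = map_mx iota (M t).
Proof.
move=> cM Mu.
have cF : (fun t => map_mx iota (M t)) \in @continuous_mx_pred (eray R) C 1.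
  apply/asboolP/continuous_mxP => i j; under eq_fun do rewrite mxE.
  move=> t; apply: (@continuous_comp _ _ _ (fun t => M t i j) iota).
    exact: cM.
  exact: iota_continuous.
have FA : CMx cF \in @algA_pred R C.
  apply/asboolP; exists (iota \o u); split.
    apply/cvg_ex; exists (iota (M None 0 0)); rewrite -cvg_shiftS /=.
    apply: (@cvg_comp _ _ _ (fun n => u n.+1) iota); last exact: iota_continuous.
    have -> : (fun n => u n.+1) = (fun n => M (nat_pt R (ltn0Sn n)) 0 0).
      by apply/funext => n; rewrite Mu !mxE eqxx mulr1n addn0.
    exact: (@cvg_comp _ _ _ (fun n => nat_pt R (ltn0Sn n)) (fun t => M t 0 0)
      _ _ _ (@nat_pt_cvg R) (cM 0 0 None)).
  move=> n n0 /=; rewrite Mu map_diag_mx; congr diag_mx.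
  by apply/rowP => j; rewrite !mxE.
by exists (AlgA FA).
Qed.

(** These are the elements diag (f(t), f(t + 1)): any [f] converging at infinity
    interpolates an admissible sequence. *)
Lemma algA_shift (f : R -> R) (L : R) :
  continuous f -> f x @[x --> +oo] --> L ->
  exists a : A, forall t,
    a t = diag_mx (\row_(j < 2) iota (ray_shift f L j t)).
Proof.
move=> cf fL.
pose M (t : eray R) : 'M[R]_2 := diag_mx (\row_(j < 2) ray_shift f L j t).
have [|n n0|a aM] := @algA_of_real M (fun n => f n%:R).
- move=> i j; have [<-|ij] := eqVneq i j; last first.
    have -> : (fun t => M t i j) = cst 0.
      by apply/funext => t; rewrite !mxE (negbTE ij) mulr0n.
    exact: cst_continuous.
  have -> : (fun t => M t i i) = ray_shift f L i.
    by apply/funext => t; rewrite !mxE eqxx mulr1n.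
  exact: ray_shift_continuous.
- by congr diag_mx; apply/rowP => j; rewrite !mxE ray_shift_nat.
- exists a => t; rewrite aM map_diag_mx; congr diag_mx.
  by apply/rowP => j; rewrite !mxE.
Qed.

(** Off the integers there is no constraint on an element of A, so it may
    have a single nonzero entry, even off the diagonal. *)
Lemma algA_unit (h : eray R -> R) (i j : 'I_2) :
  continuous h -> (forall n (n0 : (0 < n)%N), h (nat_pt R n0) = 0) ->
  exists a : A, forall t, a t = iota (h t) *: delta_mx i j.
Proof.
move=> ch h0.
have [|n n0|a aM] := @algA_of_real (fun t => h t *: delta_mx i j) (fun=> 0).
- move=> k l; have -> : (fun t => (h t *: delta_mx i j : 'M[R]_2) k l) =
      (fun t => h t * (delta_mx i j : 'M[R]_2) k l).
    by apply/funext => t; rewrite !mxE.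
  by move=> t; exact: cvgM (ch t) (cvg_cst _).
- by apply/matrixP => k l; rewrite h0 scale0r !mxE mul0rn.
- by exists a => t; rewrite aM map_mxZ map_delta_mx.
Qed.

Lemma algA_ext (a b : A) : (forall t i j, a t i j = b t i j) -> a = b.
Proof.
move=> ab; apply/val_inj/val_inj/funext => t.
by apply/matrixP => i j; exact: ab.
Qed.

Lemma algA_entryD (a b : A) t i j : (a + b) t i j = a t i j + b t i j.
Proof. by rewrite algADE mxE. Qed.

Lemma algA_entryN (a : A) t i j : (- a) t i j = - a t i j.
Proof. by rewrite -scaleN1r algAZE mxE mulN1r. Qed.

Lemma algA_entry0 t i j : (0 : A) t i j = 0.
Proof. by rewrite -(scale0r 1) algAZE mxE mul0r. Qed.

Lemma algA_entry_sum (I : Type) (r : seq I) (F : I -> A) t i j :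
  (\sum_(k <- r) F k) t i j = \sum_(k <- r) F k t i j.
Proof.
elim: r => [|k r IHr]; first by rewrite !big_nil algA_entry0.
by rewrite !big_cons algA_entryD IHr.
Qed.

Lemma mulmx_unit_unit n (M : 'M[C]_n) (c d : C) (i j k l : 'I_n) :
  ((c *: delta_mx i i) *m M *m (d *: delta_mx j j)) k l =
  c * d * M k l *+ ((k == i) && (l == j)).
Proof.
have deltaE (p : 'I_n) : delta_mx p p = diag_mx (delta_mx 0 p) :> 'M[C]_n.
  apply/matrixP => q r; rewrite !mxE eqxx /=.
  have [->|qr] := eqVneq q r; first by rewrite andbb.
  have [qp|] := eqVneq q p; last by rewrite mulr0n.
  by rewrite -qp eq_sym (negbTE qr).
rewrite -!scalemxAl -scalemxAr scalerA !deltaE mul_mx_diag mul_diag_mx.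
rewrite !mxE !eqxx /=.
by case: (k == i); case: (l == j); rewrite ?mul1r ?mulr1 ?mul0r ?mulr0.
Qed.

(** Sandwiching between multiples p, q of diagonal matrix units isolates the entry
    (i, j) and multiplies it by p q.  Both factors must vanish at the integers, so
    [h] is split as a difference of squares of such functions. *)
Lemma elementary_entry (h : eray R -> R) (i j : 'I_2) :
  continuous h -> (forall n (n0 : (0 < n)%N), h (nat_pt R n0) = 0) ->
  exists2 psi : A -> A, elementary psi & forall a t k l,
    psi a t k l = iota (h t) * a t k l *+ ((k == i) && (l == j)).
Proof.
move=> ch h0.
(* Num.sqrt is 0 on negative numbers: these are the roots of the positive and
   negative parts of h. *)
pose hp t := Num.sqrt (h t); pose hm t := Num.sqrt (- h t).
have chp : continuous hp.
  by move=> t; exact: cvg_comp (ch t) (@sqrt_continuous _ _).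
have chm : continuous hm.
  by move=> t; exact: cvg_comp (cvgN (ch t)) (@sqrt_continuous _ _).
have hp0 n (n0 : (0 < n)%N) : hp (nat_pt R n0) = 0.
  by rewrite /hp h0 sqrtr0.
have hm0 n (n0 : (0 < n)%N) : hm (nat_pt R n0) = 0.
  by rewrite /hm h0 oppr0 sqrtr0.
have hE t : h t = hp t * hp t - hm t * hm t.
  rewrite /hp /hm -!expr2; have [le0|gt0] := leP (h t) 0.
    by rewrite (ler0_sqrtr le0) sqr_sqrtr ?oppr_ge0 // expr0n /= sub0r opprK.
  by rewrite sqr_sqrtr ?ltW // ler0_sqrtr ?oppr_le0 ?ltW // expr0n /= subr0.
have [P PE] := algA_unit i i chp hp0; have [P' PE'] := algA_unit j j chp hp0.
have [Q QE] := algA_unit i i chm hm0; have [Q' QE'] := algA_unit j j chm hm0.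
exists (fun a => P * a * P' + (- Q) * a * Q').
  by apply: elementaryD; exact: elementary_mul.
move=> a t k l.
rewrite !mulNr algA_entryD algA_entryN !algAME PE PE' QE QE'.
rewrite !mulmx_unit_unit -mulrnBl -mulrBl -!rmorphM -rmorphB.
by rewrite -hE.
Qed.

(** A continuous function that vanishes on ]n, n+1[ vanishes at n. *)
Lemma continuous_eq0_nat (g : eray R -> C) :
  continuous g -> (forall t, nat_sine t != 0 -> g t = 0) ->
  forall n (n0 : (0 < n)%N), g (nat_pt R n0) = 0.
Proof.
move=> cg g0 n n0.
have n1 : (1 : R) <= n%:R by rewrite ler1n.
pose G (x : R) := g (Some (ray_clamp x)).
have -> : g (nat_pt R n0) = G n%:R.
  rewrite /G (_ : ray_clamp n%:R = nat_ray R n0) //.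
  exact: (ray_clampK (nat_ray R n0)).
have cG : {for n%:R, continuous G}.
  exact: cvg_comp (@ray_clamp_continuous R n%:R) (cg (Some (ray_clamp n%:R))).
have GG : G x @[x --> n%:R^'+] --> G n%:R by exact: cvg_at_right_filter.
have G0 : G x @[x --> n%:R^'+] --> (0 : C).
  apply: cvg_near_cst; near=> x.
  have nx : n%:R < x by near: x; exact: nbhs_right_gt.
  rewrite /G g0 //; apply: (@nat_sine_neq0 R n).
  rewrite /= max_r ?nx /=; last exact: le_trans n1 (ltW nx).
  by near: x; apply: nbhs_right_lt; rewrite ltr_nat.
exact: cvg_unique GG G0.
Unshelve. all: by end_near. Qed.

(** * Conjugation by a diagonal function *)

Section conjugation.
Variable u : 'I_2 -> eray R -> R.
Hypothesis u_continuous : forall i, continuous (u i).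
Hypothesis u_neq0 : forall i t, u i t != 0.

Lemma ratio_continuous i j : continuous (fun t => u i t / u j t).
Proof.
move=> t.
exact: cvgM (@u_continuous i t) (cvgV (u_neq0 j t) (@u_continuous j t)).
Qed.

(** Entrywise form of a |-> diag (u) a diag (u)^-1. *)
Definition conj_mx (a : A) (t : eray R) : 'M[C]_2 :=
  \matrix_(i, j) (iota (u i t / u j t) * a t i j).

Lemma conj_mx_continuous (a : A) :
  conj_mx a \in @continuous_mx_pred (eray R) C 1.
Proof.
apply/asboolP/continuous_mxP => i j.
have -> : (fun t => conj_mx a t i j) =
    (fun t => iota (u i t / u j t) * a t i j).
  by apply/funext => t; rewrite mxE.
have /continuous_mxP ca := @cmx_continuous _ _ _ (algA_val a).
move=> t; apply: cvgM (ca i j t).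
exact: cvg_comp (@ratio_continuous i j t) (@iota_continuous _).
Qed.

(** At integers [a] is diagonal, and the diagonal ratios are 1. *)
Lemma conj_mx_algA (a : A) : CMx (conj_mx_continuous a) \in @algA_pred R C.
Proof.
have /asboolP[v [cv va]] := algA_valP a.
apply/asboolP; exists v; split=> // n n0; apply/matrixP => i j /=.
rewrite mxE va !mxE; have [->|ij] := eqVneq i j; last by rewrite !mulr0n mulr0.
by rewrite divff ?u_neq0 // rmorph1 mul1r.
Qed.

Definition conj_algA (a : A) : A := AlgA (conj_mx_algA a).

Lemma conj_algAE a t i j :
  conj_algA a t i j = iota (u i t / u j t) * a t i j.
Proof. by rewrite /= mxE. Qed.

Lemma conj_algA_linear : linear conj_algA.
Proof.
move=> k a b; apply: algA_ext => t i j.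
rewrite conj_algAE !algADE !algAZE !mxE.
by rewrite mulrDr !mulrA (mulrC k).
Qed.

Lemma conj_algA_monoid_morphism : monoid_morphism conj_algA.
Proof.
split=> [|a b]; apply: algA_ext => t i j.
  rewrite conj_algAE algA1E mxE; have [->|_] := eqVneq i j.
    by rewrite divff ?u_neq0 // rmorph1 mul1r.
  by rewrite mulr0.
rewrite conj_algAE !algAME !mxE mulr_sumr; apply: eq_bigr => k _.
rewrite !conj_algAE mulrACA -rmorphM; congr (iota _ * _).
by rewrite mulrA divfK.
Qed.

HB.instance Definition _ :=
  GRing.isLinear.Build C A A *:%R conj_algA conj_algA_linear.
HB.instance Definition _ :=
  GRing.isMonoidMorphism.Build A A conj_algA conj_algA_monoid_morphism.

(** The operator a |-> a (1 - X Y) + X a Y, with X and Y the diagonal elements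
    built from [f] and [g], multiplies the entry (i, j) by 1 + (f_i - f_j) g_j.
    By hypothesis this is the right ratio at integers; the remaining four entrywise
    discrepancies vanish there and are corrected one entry at a time. *)
Lemma conj_algA_elementary (f g : R -> R) (Lf Lg : R) :
  continuous f -> f x @[x --> +oo] --> Lf ->
  continuous g -> g x @[x --> +oo] --> Lg ->
  (forall (i j : 'I_2) (n : nat) (n0 : (0 < n)%N),
    u i (nat_pt R n0) / u j (nat_pt R n0) =
    1 + (f (n + i)%:R - f (n + j)%:R) * g (n + j)%:R) ->
  elementary conj_algA.
Proof.
move=> cf fL cg gL fg.
pose F (i : 'I_2) := ray_shift f Lf i; pose G (i : 'I_2) := ray_shift g Lg i.
have cF i : continuous (F i) by exact: ray_shift_continuous.
have cG i : continuous (G i) by exact: ray_shift_continuous.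
have [X XE] := algA_shift cf fL; have [Y YE] := algA_shift cg gL.
pose h (p : 'I_2 * 'I_2) t :=
  u p.1 t / u p.2 t - (1 + (F p.1 t - F p.2 t) * G p.2 t).
have /choice[psi psiP] (p : 'I_2 * 'I_2) : exists psi : A -> A,
    elementary psi /\ forall a t i j,
      psi a t i j = iota (h p t) * a t i j *+ ((i == p.1) && (j == p.2)).
  have [t|n n0|psi ? ?] := @elementary_entry (h p) p.1 p.2; last by exists psi.
  - apply: cvgB (@ratio_continuous p.1 p.2 t) _.
    apply: cvgD (cvg_cst _) _.
    exact: cvgM (cvgB (cF p.1 t) (cF p.2 t)) (cG p.2 t).
  - by rewrite /h fg /F /G !ray_shift_nat subrr.
have -> : conj_algA =
    fun a => 1 * a * (1 - X * Y) + X * a * Y + \sum_p psi p a.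
  have XYE t : (1 - X * Y) t =
      diag_mx (\row_(j < 2) (1 - iota (F j t) * iota (G j t))).
    apply/matrixP => i j; rewrite algA_entryD algA_entryN algAME algA1E XE YE.
    rewrite mulmx_diag !mxE.
    by case: (i == j); rewrite ?mulr1n // !mulr0n subr0.
  apply/funext => a; apply: algA_ext => t i j.
  rewrite conj_algAE !algA_entryD algA_entry_sum (bigD1 (i, j)) // big1; last first.
    move=> [k l] /=; rewrite xpair_eqE (psiP _).2 /= => klij.
    by rewrite [i == k]eq_sym [j == l]eq_sym (negbTE klij) mulr0n.
  rewrite [X in _ + X]addr0 (psiP _).2 !eqxx mulr1n mul1r !algAME XE YE.
  rewrite XYE mul_diag_mx !mul_mx_diag !mxE -/(F i) -/(G j) /h /=.
  set r := (u i t / u j t); ring.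
apply: elementaryD.
  by apply: elementaryD; exact: elementary_mul.
by apply: elementary_sum => p; exact: (psiP p).1.
Qed.

(** If b implements the conjugation, then phi(e) b = b e for all e.  For e the
    multiple of the matrix unit (0, 1) by a function vanishing only at integers,
    the entry (0, 1) of this identity compares the diagonal entries of b. *)
Lemma conj_algA_inner : inner conj_algA -> exists lam : nat -> C,
  [/\ cvg (lam @ \oo), forall n, (0 < n)%N -> lam n != 0 &
    forall n (n0 : (0 < n)%N),
      lam n = iota (u 0 (nat_pt R n0) / u 1 (nat_pt R n0)) * lam n.+1].
Proof.
move=> [b [b' [bb' b'b conjE]]].
have /asboolP[lam [clam lamE]] := algA_valP b.
have /asboolP[lam' [_ lamE']] := algA_valP b'.
exists lam; split=> // [n n0|n n0].
  have := congr1 (fun a : A => a (nat_pt R n0) 0 0) bb'.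
  rewrite algAME algA1E lamE lamE' mulmx_diag !mxE eqxx !mulr1n addn0.
  by move=> ll'; apply: contra_eq_neq ll' => ->; rewrite mul0r eq_sym oner_eq0.
have [e eE] := algA_unit 0 1 (@nat_sine_continuous R) (@nat_sine_nat R).
have ebE : conj_algA e * b = b * e.
  by rewrite conjE -(mulrA (b * e)) b'b mulr1.
have /continuous_mxP cb := @cmx_continuous _ _ _ (algA_val b).
pose g (t : eray R) := b t 0 0 - iota (u 0 t / u 1 t) * b t 1 1.
have cg : continuous g.
  move=> t; apply: cvgB (cb 0 0 t) _; apply: cvgM (cb 1 1 t).
  exact: cvg_comp (@ratio_continuous 0 1 t) (@iota_continuous _).
have g0 t : nat_sine t != 0 -> g t = 0.
  move=> bt0; have /(congr1 (fun a : A => a t 0 1)) := ebE.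
  rewrite !algAME !mxE !big_ord_recl !big_ord0 !conj_algAE eE !mxE /=.
  rewrite (_ : lift ord0 ord0 = 1); last exact: val_inj.
  rewrite !(mulr0, mul0r, mulr1, add0r, addr0) => bE.
  have ib0 : iota (nat_sine t) != 0 by rewrite fmorph_eq0.
  by apply/eqP; rewrite subr_eq0; apply/eqP/(mulIf ib0); rewrite -bE mulrAC.
have := continuous_eq0_nat cg g0 n0; rewrite /g lamE !mxE eqxx !mulr1n /=.
by rewrite addn0 addn1 => /eqP; rewrite subr_eq0 => /eqP.
Qed.

End conjugation.

Lemma conj_algA_bij (u : 'I_2 -> eray R -> R)
    (cu : forall i, continuous (u i)) (u0 : forall i t, u i t != 0) :
  bijective (conj_algA cu u0).
Proof.
pose v i t := (u i t)^-1.
have cv i : continuous (v i) by move=> t; exact: cvgV (u0 i t) (cu i t).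
have v0 i t : v i t != 0 by rewrite invr_neq0.
have vu i j t : v i t / v j t * (u i t / u j t) = 1.
  by rewrite /v; field; rewrite !u0.
have uv i j t : u i t / u j t * (v i t / v j t) = 1 by rewrite mulrC vu.
exists (conj_algA cv v0) => a; apply: algA_ext => t i j.
  by rewrite !conj_algAE mulrA -rmorphM vu rmorph1 mul1r.
by rewrite !conj_algAE mulrA -rmorphM uv rmorph1 mul1r.
Qed.

(** The recurrence forces lam (4 q) to be proportional to 4 q + 5, which is
    incompatible with convergence. *)
Lemma no_harmonic_growth (lam : nat -> C) (v : nat -> R) :
  cvg (lam @ \oo) -> lam 4 != 0 ->
  (forall n, (0 < n)%N -> lam n = iota (v n)^-1 * lam n.+1) ->
  (forall n, (0 < n)%N ->
    v n = if (4 %| n)%N then (n + 9)%:R / (n + 5)%:R else 1) -> False.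
Proof.
move=> /cvg_ex[l laml] lam4 lamE vE.
have step n : (0 < n)%N -> (4 %| n)%N ->
    lam n = iota ((n + 5)%:R / (n + 9)%:R) * lam (n + 4)%N.
  move=> n0 n4; rewrite lamE // vE // n4 invf_div; congr (_ * _).
  have v1 k : (0 < k < 4)%N -> lam (n + k)%N = lam (n + k.+1)%N.
    move=> k4; rewrite addnS lamE ?vE ?addn_gt0 ?n0 //.
    rewrite (_ : (4 %| n + k)%N = false) ?invr1 ?rmorph1 ?mul1r //.
    by rewrite dvdn_addr // gtnNdvd //; case/andP: k4.
  by rewrite -addn1 (v1 1%N) // (v1 2%N) // (v1 3%N).
have growth q : lam 4 = iota (9 * harmonic (4 * q + 8)) * lam (4 * q + 4)%N.
  elim: q => [|q ->].
    by rewrite /harmonic /= divff ?pnatr_eq0 // rmorph1 mul1r.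
  rewrite step; [|by lia|by lia]; rewrite mulrA -rmorphM.
  rewrite (_ : (4 * q + 4 + 4)%N = (4 * q.+1 + 4)%N); last by lia.
  congr (iota _ * _); rewrite /harmonic /=.
  rewrite (_ : (4 * q + 8).+1 = (4 * q + 4 + 5)%N); last by lia.
  rewrite (_ : (4 * q.+1 + 8).+1 = (4 * q + 4 + 9)%N); last by lia.
  by rewrite mulrA divfK // pnatr_eq0 addn_eq0 andbF.
have sub k : (4 * q + k)%N @[q --> \oo] --> \oo.
  apply/cvgnyPge => N; near=> q; apply: leq_trans (_ : (q <= _)%N); last by lia.
  by near: q; exact: nbhs_infty_ge.
have decay : iota (9 * harmonic (4 * q + 8)) @[q --> \oo] --> (0 : C).
  rewrite -(rmorph0 iota) -(mulr0 9).
  apply: (@cvg_comp _ _ _ _ iota) (@iota_continuous _).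
  by apply: cvgMl_tmp; exact: cvg_comp (sub 8%N) cvg_harmonic.
have : (fun=> lam 4) x @[x --> \oo] --> 0 * l.
  rewrite (_ : (fun=> lam 4) = fun q => iota (9 * harmonic (4 * q + 8)) *
    lam (4 * q + 4)%N); last by apply/funext => q.
  exact: cvgM decay (cvg_comp _ _ (sub 4%N) laml).
rewrite mul0r => lam0; move/eqP: lam4; apply.
exact: cvg_unique (cvg_cst _) lam0.
Unshelve. all: by end_near. Qed.

End algebra.

(** * The weight and its factorization *)

Section twist.
Variable R : realType.
Implicit Types (x : R) (n : nat).

(** With c = cos (pi x / 2), which takes the values 1, 0, -1, 0 at integers, the
    polynomial c (1 + c) / 2 interpolates 1, 0, 0, 0: a continuous indicator of
    the multiples of 4. *)
Definition comb x := cos (pi * x / 2) * (1 + cos (pi * x / 2)) / 2.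

Lemma comb_nat n : comb n%:R = (4 %| n)%:R.
Proof.
rewrite /comb; have {1 2}-> : pi * n%:R / 2 =
    pi * (n %% 4)%:R / 2 + pi *+ 2 *+ (n %/ 4) :> R.
  rewrite {1}(divn_eq n 4) natrD natrM -mulr_natr -(mulr_natr pi).
  by field.
rewrite (periodicn (@cosD2pi R)) /dvdn.
have := ltn_pmod n (isT : (0 < 4)%N).
case: (n %% 4)%N => [|[|[|[|//]]]] _ /=.
- by rewrite mulr0 mul0r cos0; field.
- by rewrite mulr1 cos_pihalf; field.
- by rewrite mulfK // cospi; field.
- rewrite (_ : pi * 3 / 2 = pi / 2 + pi); last by field.
  by rewrite cosDpi cos_pihalf; field.
Qed.

(** c (1 + c) / 2 = ((c + 1/2)^2 - 1/4) / 2.  This small overshoot below 0 is why the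
    weight stays positive between integers. *)
Lemma comb_ge x : - (1 / 8) <= comb x.
Proof.
rewrite /comb; set c := cos _.
have := sqr_ge0 (c + 1 / 2); lra.
Qed.

Lemma comb_norm_le x : `|comb x| <= 1.
Proof.
rewrite ler_norml (le_trans _ (comb_ge x)) /comb /=; last by lra.
have := cos_le1 (pi * x / 2); have := cos_geN1 (pi * x / 2).
set c := cos _; nra.
Qed.

Lemma comb_continuous : continuous comb.
Proof.
have cc : continuous (fun x => cos (pi * x / 2)).
  move=> x; apply: (@cvg_comp _ _ _ (fun x => pi * x / 2) cos).
    by apply: cvgMr_tmp; exact: mulrl_continuous.
  exact: continuous_cos.
move=> x; apply: cvgMr_tmp; apply: cvgM (cc x) _.
by apply: cvgD (cc x); exact: cvg_cst.
Qed.

(** The square is of order 1/x: amplitudes vanish at infinity while the sum of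
    their squares over the multiples of 4 diverges. *)
Definition amp x : R := 2 * Num.sqrt (1 + `|x|)^-1.

Lemma amp_sqr x : amp x * amp x = 4 / (1 + `|x|).
Proof.
rewrite /amp mulrACA -[X in _ * X]expr2 sqr_sqrtr; first by congr (_ * _); lra.
by rewrite invr_ge0 addr_ge0.
Qed.

Lemma amp_continuous : continuous amp.
Proof.
move=> x; apply: cvgMl_tmp.
exact: cvg_comp (@decay_continuous R x) (@sqrt_continuous R _).
Qed.

Lemma cvg_amp : amp x @[x --> +oo] --> (0 : R).
Proof.
rewrite -(mulr0 2) -(sqrtr0 R); apply: cvgMl_tmp.
exact: cvg_comp (@cvg_decay R) (@sqrt_continuous R _).
Qed.

Definition tooth x := comb x * amp x.
Definition dual_tooth x := comb x * amp x / (1 + amp x * amp x).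
(** The arguments are shifted by 4, a period of [comb], so that the three
    functions below only involve nonnegative shifts. *)
Definition weight x := 1 + tooth (x + 4) * amp (x + 4).

(** At n = 0, 1, 2, 3 modulo 4, [wave] takes the values 0, a, a, 0 and [dual_wave]
    the values a, a / (1 + a^2), 0, 0, where a is the amplitude of the current
    period.  Thus [wave] changes between n and n + 1 while [dual_wave] is nonzero
    only when n is a multiple of 4; the other change, from a back to 0, occurs where
    [dual_wave] vanishes. *)
Definition wave x := tooth (x + 3) + tooth (x + 2).
Definition dual_wave x := tooth (x + 4) + dual_tooth (x + 3).

Lemma tooth_continuous : continuous tooth.
Proof. by move=> x; exact: cvgM (@comb_continuous x) (@amp_continuous x). Qed.

Lemma cvg_tooth : tooth x @[x --> +oo] --> (0 : R).
Proof. exact: cvg_bounded_mul0 comb_norm_le cvg_amp. Qed.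

Lemma amp_sqr_ge1 x : 1 <= 1 + amp x * amp x.
Proof. by rewrite lerDl -expr2 sqr_ge0. Qed.

Lemma dual_tooth_continuous : continuous dual_tooth.
Proof.
move=> x; apply: cvgM (@tooth_continuous x) _; apply: cvgV.
  by rewrite gt_eqF // (lt_le_trans ltr01 (amp_sqr_ge1 x)).
apply: cvgD; first exact: cvg_cst.
exact: cvgM (@amp_continuous x) (@amp_continuous x).
Qed.

Lemma cvg_dual_tooth : dual_tooth x @[x --> +oo] --> (0 : R).
Proof.
rewrite /dual_tooth; under eq_fun do rewrite mulrC.
apply: (@cvg_bounded_mul0 R (fun x => (1 + amp x * amp x)^-1) _ 1 _ cvg_tooth) => x.
have := amp_sqr_ge1 x; move: (1 + _) => y y1.
rewrite ger0_norm ?invf_le1 ?invr_ge0 // ?(le_trans ler01 y1) //.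
exact: lt_le_trans y1.
Qed.

Lemma wave_continuous : continuous wave.
Proof.
by move=> x; apply: cvgD; apply: continuous_shift; exact: tooth_continuous.
Qed.

Lemma cvg_wave : wave x @[x --> +oo] --> (0 : R).
Proof. by rewrite -(addr0 0); apply: cvgD; apply: cvg_shift; exact: cvg_tooth. Qed.

Lemma dual_wave_continuous : continuous dual_wave.
Proof.
move=> x; apply: cvgD; apply: continuous_shift.
  exact: tooth_continuous.
exact: dual_tooth_continuous.
Qed.

Lemma cvg_dual_wave : dual_wave x @[x --> +oo] --> (0 : R).
Proof.
rewrite -(addr0 0); apply: cvgD; apply: cvg_shift; first exact: cvg_tooth.
exact: cvg_dual_tooth.
Qed.

Lemma weight_continuous : continuous weight.
Proof.
move=> x; apply: cvgD; first exact: cvg_cst.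
apply: cvgM; apply: continuous_shift; first exact: tooth_continuous.
exact: amp_continuous.
Qed.

Lemma cvg_weight : weight x @[x --> +oo] --> (1 : R).
Proof.
rewrite -(addr0 1) -(mulr0 0); apply: cvgD; first exact: cvg_cst.
apply: cvgM; apply: cvg_shift; [exact: cvg_tooth | exact: cvg_amp].
Qed.

(** Since the squared amplitude is at most 4 and the comb at least -1/8, the
    weight is at least 1/2. *)
Lemma weight_gt0 x : 0 < weight x.
Proof.
rewrite /weight /tooth -mulrA amp_sqr.
have := comb_ge (x + 4).
have : 0 <= 4 / (1 + `|x + 4|) <= 4.
  rewrite divr_ge0 ?addr_ge0 //= ler_pdivrMr ?ltr_pwDl //.
  by rewrite ler_peMr // lerDl.
by move: (4 / _) (comb _) => y c /andP[y0 y4] c8; nra.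
Qed.

Lemma tooth_nat n : tooth n%:R = amp n%:R *+ (4 %| n)%N.
Proof. by rewrite /tooth comb_nat mulr_natl. Qed.

Lemma dual_tooth_nat n :
  dual_tooth n%:R = amp n%:R / (1 + amp n%:R * amp n%:R) *+ (4 %| n)%N.
Proof. by rewrite /dual_tooth comb_nat mulr_natl mulrnAl. Qed.

Lemma wave_nat n : wave n%:R = tooth (n + 3)%:R + tooth (n + 2)%:R.
Proof. by rewrite /wave !natrD. Qed.

Lemma dual_wave_nat n : dual_wave n%:R = tooth (n + 4)%:R + dual_tooth (n + 3)%:R.
Proof. by rewrite /dual_wave !natrD. Qed.

Lemma weight_nat n :
  weight n%:R = 1 + amp (n + 4)%:R * amp (n + 4)%:R *+ (4 %| n)%N.
Proof. by rewrite /weight -natrD tooth_nat dvdn_addl // mulrnAl. Qed.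

Lemma dvd4D n k : (4 %| n + k)%N = (4 %| n %% 4 + k)%N.
Proof. by rewrite /dvdn modnDml. Qed.

Lemma weight_wave n : weight n%:R =
  1 + (wave n.+1%:R - wave n%:R) * dual_wave n%:R.
Proof.
rewrite !wave_nat dual_wave_nat weight_nat !addSnnS !tooth_nat dual_tooth_nat.
rewrite -[in (4 %| n)%N](addn0 n) !(dvd4D n).
have := ltn_pmod n (isT : (0 < 4)%N).
by case: (n %% 4)%N => [|[|[|[|//]]]] _ /=; rewrite ?mulr1n ?mulr0n; ring.
Qed.

(** For 4 dividing n this is 1 / (1 + a^2) = 1 - a * (a / (1 + a^2)), which dictates
    the second value of [dual_wave]. *)
Lemma weightV_wave n : (weight n%:R)^-1 =
  1 + (wave n%:R - wave n.+1%:R) * dual_wave n.+1%:R.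
Proof.
rewrite !wave_nat dual_wave_nat weight_nat !addSnnS !tooth_nat dual_tooth_nat.
have := amp_sqr_ge1 (n + 4)%:R; set y := 1 + _ => y1.
have y0 : y != 0 by rewrite gt_eqF // (lt_le_trans ltr01).
rewrite -[in (4 %| n)%N](addn0 n) !(dvd4D n).
have := ltn_pmod n (isT : (0 < 4)%N).
case: (n %% 4)%N => [|[|[|[|//]]]] _ /=; rewrite ?mulr1n ?mulr0n; last 3 first.
- by field.
- by field.
- by field.
by move: y0; rewrite /y; move: (amp _) => a a0; field.
Qed.

End twist.

(** * The outer elementary automorphism *)

Theorem proposition4p6 (R : realType) :
  exists phi : {lrmorphism algA R R[i] -> algA R R[i]},
    [/\ bijective phi, outer phi & elementary phi].
Proof.
pose C : numClosedFieldType := R[i].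
pose iota : {rmorphism R -> C} := real_complex R.
have ciota : continuous iota := @real_complex_continuous R.
pose u (i : 'I_2) (t : eray R) := if i == 0 then 1 else ray_ext (@weight R) 1 t.
have uE i n (n0 : (0 < n)%N) :
    u i (nat_pt R n0) = if i == 0 then 1 else weight n%:R by [].
have cu i : continuous (u i).
  rewrite /u; case: (i == 0); first exact: cst_continuous.
  exact: ray_ext_continuous (@weight_continuous R) (@cvg_weight R).
have u0 i t : u i t != 0.
  rewrite /u; case: (i == 0); first exact: oner_neq0.
  by case: t => [r|] /=; [rewrite gt_eqF // weight_gt0 | exact: oner_neq0].
exists (conj_algA ciota cu u0); split.
- exact: conj_algA_bij.
- move=> /conj_algA_inner[lam [clam lam0 lamE]].
  apply: (@no_harmonic_growth R C iota ciota lam (fun n => weight n%:R) clam).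
  + exact: lam0.
  + by move=> n n0; rewrite (lamE n n0) !uE /= div1r.
  + move=> n _; rewrite weight_nat amp_sqr.
    case: (4 %| n)%N; rewrite ?mulr1n ?mulr0n ?addr0 // ger0_norm //.
    rewrite !natrD; field.
    by rewrite -natrD pnatr_eq0 addn_eq0 andbF.
- apply: conj_algA_elementary (@wave_continuous R) (@cvg_wave R)
    (@dual_wave_continuous R) (@cvg_dual_wave R) _ => i j n n0.
  rewrite !uE.
  case: i => -[|[|//]] ?; case: j => -[|[|//]] ? /=; rewrite ?addn0 ?addn1.
  + by rewrite subrr mul0r addr0 divr1.
  + by rewrite div1r weightV_wave.
  + by rewrite divr1 weight_wave.
  + by rewrite subrr mul0r addr0 divff // gt_eqF // weight_gt0.
Qed.
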